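(* Let $(X,\mu)$ be a group chunk on a site $\mathcal C$. Then the compatibility relation $\sim$ is an equivalence relation on $\widetilde X^{(\infty)}$ (i.e. on $\widetilde X^{(\infty)}(T)$ for every object $T$).
   Context: Sites are small. A partial morphism $\phi\colon X\dashrightarrow Y$ is a subobject $\operatorname{dom}\phi\hookrightarrow X$ with a morphism $\operatorname{dom}\phi\to Y$; $\psi\circ\phi$ has as domain the preimage of $\operatorname{dom}\psi$ under $\phi$. Two partial morphisms $X\dashrightarrow Y$ are compatible, $\phi\sim\psi$, if they agree on $\operatorname{dom}\phi\cap\operatorname{dom}\psi$. A presheaf of partial magmas $(X,\mu)$ is a presheaf $X$ with a partial morphism $\mu\colon X\times X\dashrightarrow X$. Let $\Gamma_\mu\subset X^3$ be the graph of $\mu$. $\mu$ is cancellative if for all $i<j$ in $\{1,2,3\}$ the projection $\Gamma_\mu\to X_i\times X_j$ (with $X_i=X$) is a monomorphism; then $\Gamma_\mu$ is the graph of a partial morphism $\mu_{ij}\colon X_i\times X_j\dashrightarrow X_k$, and $\mu=\mu_{12}$. A cancellative $\mu$ is strongly associative if, whenever both sides are defined on sections, $\mu(x_1,\mu(x_2,x_3))=\mu(\mu(x_1,x_2),x_3)$ and $\mu_{13}(x_1,\mu(x_2,x_3))=\mu(\mu_{13}(x_1,x_2),x_3)$. For $T\in\mathcal C$, $X_T$ is the presheaf $(T'\to T)\mapsto X(T')$ on the slice category $\mathcal C_T$. For $x\in X(T)$, $\lambda_x,\lambda_x^\dagger\colon X_T\dashrightarrow X_T$ are the partial morphisms $z\in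 X(T')\mapsto\mu(x|_{T'},z)$ and $z\mapsto\mu_{13}(x|_{T'},z)$, defined where the right-hand sides are. $\widetilde X(T)$ is the set of partial morphisms of the form $\lambda_x$ or $\lambda_x^\dagger$, $x\in X(T)$; $\widetilde X^{(\infty)}(T)$ is the set of finite nonempty compositions of elements of $\widetilde X(T)$. A subpresheaf $F\subset X_T$ is locally nontrivial if there is a covering sieve $S$ of $T$ with $F(T'\to T)\ne\emptyset$ for every $T'\to T$ in $S$. $\mu$ has large domain if for all $T$, $N>0$ and $\alpha_1,\dots,\alpha_N,\beta_1,\dots,\beta_N\in\widetilde X(T)$ the intersection $\bigcap_i\operatorname{dom}(\alpha_i\circ\beta_i)$ is locally nontrivial. A group chunk is a presheaf of partial magmas that is separated, cancellative, strongly associative and has large domain. *)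

(* Defs.v *)
From Stdlib Require Export RelationClasses.
From mathcomp Require Export all_boot.
From mathcomp Require Import boolp.

Set Implicit Arguments.
Unset Strict Implicit.
Unset Printing Implicit Defensive.

(* comph f g is f after g. *)
Record category := Category {
  obj :> Type;
  hom : obj -> obj -> Type;
  idh : forall a, hom a a;
  comph : forall a b c, hom b c -> hom a b -> hom a c;
  comph1 : forall a b (f : hom a b), comph f (idh a) = f;
  comp1h : forall a b (f : hom a b), comph (idh b) f = f;
  comphA : forall a b c d (f : hom c d) (g : hom b c) (h : hom a b),
    comph f (comph g h) = comph (comph f g) h
}.
Arguments idh {c} a : rename.

Record presheaf (C : category) := Presheaf {
  sec :> C -> Type;
  res : forall T' T : C, hom T' T -> sec T -> sec T';
  res1 : forall (T : C) (x : sec T), res (idh T) x = x;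
  res_comp : forall (T'' T' T : C) (f : hom T' T) (g : hom T'' T') (x : sec T),
    res (comph f g) x = res g (res f x)
}.

Record morphism (C : category) (X Y : presheaf C) := Morphism {
  mor :> forall T : C, X T -> Y T;
  mor_nat : forall (T' T : C) (f : hom T' T) (x : X T),
    mor (res f x) = res f (mor x)
}.

Section Presheaves.
Variable C : category.
Implicit Types X Y Z : presheaf C.

Lemma morphism_ext X Y (p q : morphism X Y) :
  (forall (T : C) (x : X T), p T x = q T x) -> p = q.
Proof.
case: p q => [p pn] [q qn] /= pq.
have E : p = q.
  by apply: functional_extensionality_dep => T; apply/funext => x; exact: pq.
by subst q; rewrite (Prop_irrelevance pn qn).
Qed.

Definition compm X Y Z (p : morphism Y Z) (q : morphism X Y) : morphism X Z.
Proof.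
by exists (fun T x => p T (q T x)) => T' T f x; rewrite !mor_nat.
Defined.

Definition mono X Y (p : morphism X Y) : Prop :=
  forall Z (g h : morphism Z X), compm p g = compm p h -> g = h.

Definition yoneda (T : C) : presheaf C.
Proof.
exists (fun T' => hom T' T) (fun _ _ g f => comph f g).
- by move=> T' f; rewrite comph1.
- by move=> T1 T2 T3 f g x; rewrite comphA.
Defined.

Definition yoneda_mor X (T : C) (x : X T) : morphism (yoneda T) X.
Proof.
by exists (fun T' (f : yoneda T T') => res f x) => T1 T2 f g; rewrite -res_comp.
Defined.

Lemma mono_inj X Y (p : morphism X Y) : mono p ->
  forall (T : C) (x y : X T), p T x = p T y -> x = y.
Proof.
move=> pm T x y pxy.
have /pm E : compm p (yoneda_mor x) = compm p (yoneda_mor y).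
  by apply: morphism_ext => T' f /=; rewrite !mor_nat pxy.
have := congr1 (fun m : morphism (yoneda T) X => m T (idh T)) E.
by rewrite /= !res1.
Qed.

Definition prod_presheaf X Y : presheaf C.
Proof.
exists (fun T => X T * Y T)%type (fun _ _ f x => (res f x.1, res f x.2)).
- by move=> T [x y]; rewrite !res1.
- by move=> T1 T2 T3 f g [x y]; rewrite !res_comp.
Defined.

Record subpresheaf X := Subpresheaf {
  mem_sub :> forall T : C, X T -> Prop;
  mem_res : forall (T' T : C) (f : hom T' T) (x : X T),
    mem_sub x -> mem_sub (res f x)
}.

Definition presheaf_of_sub X (F : subpresheaf X) : presheaf C.
Proof.
exists (fun T => {x : X T | F T x})
       (fun _ _ f x => exist _ (res f (proj1_sig x)) (mem_res f (proj2_sig x))).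
- by move=> T [x xF]; apply: eq_exist; rewrite res1.
- by move=> T1 T2 T3 f g [x xF]; apply: eq_exist; rewrite res_comp.
Defined.

Definition full_sub X : subpresheaf X.
Proof. by exists (fun _ _ => True). Defined.

Definition bigcap_sub X (I : Type) (F : I -> subpresheaf X) : subpresheaf X.
Proof.
by exists (fun T x => forall i, F i T x) => T' T f x xF i; apply: mem_res.
Defined.

Definition preim_sub X Y (p : morphism X Y) (F : subpresheaf Y) : subpresheaf X.
Proof.
by exists (fun T x => F T (p T x)) => T' T f x xF; rewrite mor_nat; apply: mem_res.
Defined.

(* By extensionality and proof irrelevance, Leibniz equality of partial
   morphisms is equality of domains and of values. *)
Record partial X Y := Partial {
  dom : subpresheaf X;
  pfun : morphism (presheaf_of_sub dom) Y
}.

Definition papp X Y (phi : partial X Y) (T : C) (x : X T) (xd : dom phi T x) : Y T :=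
  pfun phi T (exist _ x xd).

Lemma papp_eq X Y (phi : partial X Y) (T : C) (x y : X T)
    (xd : dom phi T x) (yd : dom phi T y) :
  x = y -> papp xd = papp yd.
Proof. by move=> xy; subst y; rewrite (Prop_irrelevance xd yd). Qed.

Lemma papp_res X Y (phi : partial X Y) (T' T : C) (f : hom T' T) (x : X T)
    (xd : dom phi T x) (fxd : dom phi T' (res f x)) :
  papp fxd = res f (papp xd).
Proof.
by rewrite -(mor_nat (pfun phi)) /papp /=; congr (pfun phi T' _); apply: eq_exist.
Qed.

Definition comp_dom X Y Z (psi : partial Y Z) (phi : partial X Y) : subpresheaf X.
Proof.
exists (fun T x => exists xd : dom phi T x, dom psi T (papp xd)).
move=> T' T f x [xd yd]; exists (mem_res f xd).
by rewrite (papp_res xd); apply: mem_res.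
Defined.

Definition compp X Y Z (psi : partial Y Z) (phi : partial X Y) : partial X Z.
Proof.
exists (comp_dom psi phi).
exists (fun T (x : presheaf_of_sub (comp_dom psi phi) T) =>
  papp (ex_proj2 (proj2_sig x))).
move=> T' T f [x [xd yd]] /=.
have e : papp (mem_res f xd) = res f (papp xd) by exact: papp_res.
have fyd : dom psi T' (res f (papp xd)) by apply: mem_res.
rewrite -(papp_res yd fyd); apply: papp_eq.
by rewrite -e; apply: papp_eq.
Defined.

Definition compatible X Y (phi psi : partial X Y) : Prop :=
  forall (T : C) (x : X T) (xd : dom phi T x) (xd' : dom psi T x),
    papp xd = papp xd'.

Definition image_sub X Y (p : morphism X Y) : subpresheaf Y.
Proof.
exists (fun T y => exists x, p T x = y) => T' T f y [x <-].
by exists (res f x); rewrite mor_nat.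
Defined.

(* The partial morphism X --> Y represented by the subobject p : G -> X and the
   morphism q : G -> Y. As p is a monomorphism, the section chosen by cid in
   the fibre of p is unique. *)
Definition partial_of_mono G X Y (p : morphism G X) (q : morphism G Y)
  (pm : mono p) : partial X Y.
Proof.
exists (image_sub p).
exists (fun T (x : presheaf_of_sub (image_sub p) T) =>
  q T (proj1_sig (cid (proj2_sig x)))).
move=> T' T f [x xd] /=.
rewrite -mor_nat; congr (q T' _); apply: (mono_inj pm).
by rewrite mor_nat; do 2!case: cid => ? /= ->.
Defined.

Section Magma.
Variables (X : presheaf C) (mu : partial (prod_presheaf X X) X).

Definition graph : subpresheaf (prod_presheaf (prod_presheaf X X) X).
Proof.
exists (fun T x => exists xd : dom mu T x.1, papp xd = x.2).
by move=> T' T f [x z] [xd /= <-]; exists (mem_res f xd); apply: papp_res.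
Defined.

Notation Gamma := (presheaf_of_sub graph).

Definition proj12 : morphism Gamma (prod_presheaf X X).
Proof.
by exists (fun T (g : Gamma T) => ((proj1_sig g).1.1, (proj1_sig g).1.2)).
Defined.

Definition proj13 : morphism Gamma (prod_presheaf X X).
Proof.
by exists (fun T (g : Gamma T) => ((proj1_sig g).1.1, (proj1_sig g).2)).
Defined.

Definition proj23 : morphism Gamma (prod_presheaf X X).
Proof.
by exists (fun T (g : Gamma T) => ((proj1_sig g).1.2, (proj1_sig g).2)).
Defined.

Definition proj2 : morphism Gamma X.
Proof. by exists (fun T (g : Gamma T) => (proj1_sig g).1.2). Defined.

Record cancellative : Prop := Cancellative {
  mono12 : mono proj12;
  mono13 : mono proj13;
  mono23 : mono proj23
}.

(* mu13 (x, z) = y iff mu (x, y) = z. *)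
Definition mu13 (hc : cancellative) : partial (prod_presheaf X X) X :=
  partial_of_mono proj2 (mono13 hc).

Definition strongly_associative (hc : cancellative) : Prop :=
  (forall (T : C) (x1 x2 x3 : X T)
      (d23 : dom mu T (x2, x3)) (d1 : dom mu T (x1, papp d23))
      (d12 : dom mu T (x1, x2)) (d3 : dom mu T (papp d12, x3)),
      papp d1 = papp d3) /\
  (forall (T : C) (x1 x2 x3 : X T)
      (d23 : dom mu T (x2, x3)) (d1 : dom (mu13 hc) T (x1, papp d23))
      (d12 : dom (mu13 hc) T (x1, x2)) (d3 : dom mu T (papp d12, x3)),
      papp d1 = papp d3).

End Magma.
End Presheaves.

Definition sieve (C : category) (T : C) : Type := subpresheaf (yoneda T).

Record site := Site {
  site_cat :> category;
  covering : forall T : site_cat, sieve T -> Prop;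
  covering_max : forall T : site_cat, covering (full_sub (yoneda T));
  covering_pullback : forall (T' T : site_cat) (f : hom T' T) (S : sieve T),
    covering S -> covering (preim_sub (yoneda_mor (X := yoneda T) f) S);
  covering_trans : forall (T : site_cat) (S R : sieve T), covering S ->
    (forall (T' : site_cat) (f : hom T' T), S T' f ->
      covering (preim_sub (yoneda_mor (X := yoneda T) f) R)) ->
    covering R
}.

Definition separated (C : site) (X : presheaf C) : Prop :=
  forall (T : C) (S : sieve T), covering S ->
  forall x y : X T,
    (forall (T' : C) (f : hom T' T), S T' f -> res f x = res f y) -> x = y.

Section Slice.
Variables (C : category) (T : C).

Record slice_obj := SliceObj { src : C; arr : hom src T }.

Definition slice_hom (a b : slice_obj) : Type :=
  {h : hom (src a) (src b) | comph (arr b) h = arr a}.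

Definition slice_id (a : slice_obj) : slice_hom a a :=
  exist _ (idh (src a)) (comph1 (arr a)).

Definition slice_comp (a b c : slice_obj) (g : slice_hom b c)
  (f : slice_hom a b) : slice_hom a c.
Proof.
exists (comph (proj1_sig g) (proj1_sig f)).
by rewrite comphA (proj2_sig g) (proj2_sig f).
Defined.

Definition slice : category.
Proof.
exists slice_obj slice_hom slice_id slice_comp.
- by move=> a b [f ?]; apply: eq_exist; rewrite /= comph1.
- by move=> a b [f ?]; apply: eq_exist; rewrite /= comp1h.
- by move=> a b c d [f ?] [g ?] [h ?]; apply: eq_exist; rewrite /= comphA.
Defined.

End Slice.

(* The presheaf X_T on the slice category. *)
Definition over (C : category) (X : presheaf C) (T : C) : presheaf (slice T).
Proof.
exists (fun a : slice T => X (src a))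
  (fun (a b : slice T) (h : hom a b) (x : X (src b)) => res (proj1_sig h) x).
- by move=> a x; rewrite /= res1.
- by move=> a b c f g x; rewrite /= res_comp.
Defined.

(* lmul mu x is lambda_x and lmul mu13 x is lambda_x^dagger. *)
Section LeftMultiplication.
Variables (C : category) (X : presheaf C) (nu : partial (prod_presheaf X X) X).
Variables (T : C) (x : X T).

Lemma lmul_res (a b : slice T) (h : hom a b) (z : over X T b) :
  (res (arr a) x, res h z) =
  res (p := prod_presheaf X X) (proj1_sig h) (res (arr b) x, z).
Proof. by case: h => h /= <-; rewrite res_comp. Qed.

Definition lmul_dom : subpresheaf (over X T).
Proof.
exists (fun (a : slice T) (z : over X T a) =>
  dom nu (src a) (res (arr a) x, z)).
by move=> a b h z zd; rewrite lmul_res; apply: mem_res.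
Defined.

Definition lmul : partial (over X T) (over X T).
Proof.
exists lmul_dom.
exists (fun (a : slice T) (z : presheaf_of_sub lmul_dom a) =>
  papp (phi := nu) (proj2_sig z)).
move=> a b h [z zd] /=.
rewrite -(papp_res zd (mem_res (proj1_sig h) zd)).
by apply: papp_eq; exact: lmul_res.
Defined.

End LeftMultiplication.

Section GroupChunk.
Variables (C : site) (X : presheaf C) (mu : partial (prod_presheaf X X) X).

Definition tilde (hc : cancellative mu) (T : C)
    (phi : partial (over X T) (over X T)) : Prop :=
  exists x : X T, phi = lmul mu x \/ phi = lmul (mu13 hc) x.

Inductive tilde_infty (hc : cancellative mu) (T : C) :
    partial (over X T) (over X T) -> Prop :=
| tilde_infty1 phi : tilde hc phi -> tilde_infty hc phi
| tilde_infty_comp phi psi :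
    tilde_infty hc phi -> tilde_infty hc psi -> tilde_infty hc (compp phi psi).

Definition locally_nontrivial (T : C) (F : subpresheaf (over X T)) : Prop :=
  exists2 S : sieve T, covering S &
    forall (T' : C) (f : hom T' T), S T' f ->
      exists z, F (SliceObj f : slice T) z.

Definition large_domain (hc : cancellative mu) : Prop :=
  forall (T : C) (N : nat), 0 < N ->
  forall alpha beta : 'I_N -> partial (over X T) (over X T),
    (forall i, tilde hc (alpha i)) -> (forall i, tilde hc (beta i)) ->
    locally_nontrivial (bigcap_sub (fun i => dom (compp (alpha i) (beta i)))).

Record group_chunk : Prop := GroupChunk {
  chunk_separated : separated X;
  chunk_cancellative : cancellative mu;
  chunk_associative : strongly_associative chunk_cancellative;
  chunk_large_domain : large_domain chunk_cancellative
}.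

End GroupChunk.

(* Main.v *)
Require Import Defs.
From Stdlib Require List.
From mathcomp Require Import boolp.

(** Reflexivity and symmetry are immediate; transitivity holds because an
element of the infinite tilde presheaf behaves like left multiplication by an
element of a group, hence is determined by its value at a single section.

Such an element is a word in the letters lambda_x and lambda_x^dagger. Strong
associativity says that a letter commutes with right multiplication by u as
soon as everything in sight is defined; by induction, if a word w is defined at
y then w (y u) = (w y) u for all u satisfying finitely many conditions, each
asking that a composite of only two letters be defined at u ([translate_run]).
The large domain axiom provides such u locally. This has two consequences.

- Finitely many words of any length have locally a common point of definition
  ([eq_on_common_domain]). If y is in the domain of words of length n, then for
  generic u the section y u is in the domain of their extensions by one letter.

- Two words v and w that agree at y agree at any z where both are defined
  ([agree_at_one_point]). For u in the domain of enough words, put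
  s = lambda_z^dagger (lambda_y u), so that y u = z s. Then
  (v z) s = v (z s) = v (y u) = (v y) u, and likewise for w, so that
  (v z) s = (w z) s; now cancel s.

Given phi ~ psi ~ chi and a section z in the domains of phi and chi, choose
locally y in the domains of all three: phi and chi agree at y through psi,
hence at z.

A property holding locally is only ever used to prove an equality of sections,
which may be checked locally because X is separated. Accordingly, the local
existence of a section with some property is expressed below in
continuation-passing form: two sections are equal if they become equal after
every restriction over which such a section exists. *)

Set Implicit Arguments.
Unset Strict Implicit.
Unset Printing Implicit Defensive.

(** * The multiplication as a relation *)

Section Words.
Variables (C : site) (X : presheaf C) (mu : partial (prod_presheaf X X) X).
Hypothesis hX : group_chunk mu.

Let hc : cancellative mu := chunk_cancellative hX.

Definition product (T : C) (x y z : X T) : Prop :=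
  exists d : dom mu T (x, y), papp d = z.

Lemma product_res (T' T : C) (f : hom T' T) (x y z : X T) :
  product x y z -> product (res f x) (res f y) (res f z).
Proof. by case=> d <-; exists (mem_res f d); apply: (papp_res (f := f) d). Qed.

Lemma product_fun (T : C) (x y z z' : X T) :
  product x y z -> product x y z' -> z = z'.
Proof. by case=> d <- [d' <-]; apply: papp_eq. Qed.

Definition graph_point (T : C) (x y z : X T) (m : product x y z) :
  presheaf_of_sub (graph mu) T :=
  exist (fun g => graph mu T g) ((x, y), z) m.

Lemma product_cancelr (T : C) (x x' y z : X T) :
  product x y z -> product x' y z -> x = x'.
Proof.
move=> m m'.
have := mono_inj (mono23 hc) (x := graph_point m) (y := graph_point m') erefl.
by move=> /(congr1 (fun g => (proj1_sig g).1.1)).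
Qed.

Lemma mu13E (T : C) (x y z : X T) :
  (exists d : dom (mu13 hc) T (x, z), papp d = y) <-> product x y z.
Proof.
split=> [[d <-]|m].
  rewrite /papp /=; case: cid => -[[[x' y'] z'] m] /= [<- <-]; exact: m.
have d : dom (mu13 hc) T (x, z) by exists (graph_point m).
exists d; rewrite /papp /=; case: cid => g /= e.
by rewrite (mono_inj (mono13 hc) (x := g) (y := graph_point m) e).
Qed.

(** * Letters and words *)

(** [(true, x)] stands for lambda_x and [(false, x)] for lambda_x^dagger.
Keeping the section x rather than the partial morphism lets letters be
restricted along any morphism of the site. *)
Definition letter (T : C) := (bool * X T)%type.

Definition act (T : C) (a : letter T) (y z : X T) : Prop :=
  if a.1 then product a.2 y z else product a.2 z y.

Definition res_letter (T' T : C) (f : hom T' T) (a : letter T) : letter T' :=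
  (a.1, res f a.2).

Definition lmul_letter (T : C) (a : letter T) : partial (over X T) (over X T) :=
  lmul (if a.1 then mu else mu13 hc) a.2.

Lemma lmul_letterE (T : C) (a : letter T) (o : slice T) (y z : over X T o) :
  (exists d : dom (lmul_letter a) o y, papp d = z) <->
  act (res_letter (arr o) a) y z.
Proof.
case: a => -[] x; first by [].
exact: mu13E.
Qed.

Lemma tilde_letter (T : C) (a : letter T) : tilde hc (lmul_letter a).
Proof. by exists a.2; rewrite /lmul_letter; case: a.1; [left | right]. Qed.

Lemma act_res (T' T : C) (f : hom T' T) (a : letter T) (y z : X T) :
  act a y z -> act (res_letter f a) (res f y) (res f z).
Proof. by case: a => -[] x; apply: product_res. Qed.

Lemma act_fun (T : C) (a : letter T) (y z z' : X T) :
  act a y z -> act a y z' -> z = z'.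
Proof.
case: a => -[] x; first exact: product_fun.
by move=> /mu13E[d <-] /mu13E[d' <-]; apply: papp_eq.
Qed.

(** The two halves of strong associativity in one form: the letter [a] commutes
with right multiplication by [u]. *)
Lemma act_product (T : C) (a : letter T) (y y' u p q r : X T) :
  act a y y' -> product y u p -> act a p q -> product y' u r -> q = r.
Proof.
have [assoc assoc'] := chunk_associative hX.
case: a => -[] x.
  move=> [d12 <-] [d23 <-] [d1 <-] [d3 <-]; exact: assoc.
move=> /mu13E[d12 <-] [d23 <-] /mu13E[d1 <-] [d3 <-]; exact: assoc'.
Qed.

Definition word (T : C) := seq (letter T).

Definition res_word (T' T : C) (f : hom T' T) (w : word T) : word T' :=
  map (res_letter f) w.

(** The head of the word acts first, so that concatenation is composition in the
reverse order. *)
Fixpoint run (T : C) (w : word T) (y z : X T) : Prop :=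
  if w is a :: w' then exists2 m, act a y m & run w' m z else y = z.

Definition runs (T : C) (w : word T) (y : X T) : Prop := exists z, run w y z.

Lemma res_word_comp (T'' T' T : C) (f : hom T' T) (g : hom T'' T') (w : word T) :
  res_word (comph f g) w = res_word g (res_word f w).
Proof.
rewrite /res_word -map_comp; apply: eq_map => a.
by rewrite /res_letter /= res_comp.
Qed.

Lemma run_cat (T : C) (v w : word T) (y z : X T) :
  run (v ++ w) y z <-> exists2 m, run v y m & run w m z.
Proof.
elim: v y => [|a v IH] y /=; first by split=> [|[_ <-]]; first by exists y.
split=> [[m am /IH[n vn wn]]|[n [m am vn] wn]].
  by exists n => //; exists m.
by exists m => //; apply/IH; exists n.
Qed.

Lemma run_fun (T : C) (w : word T) (y z z' : X T) :
  run w y z -> run w y z' -> z = z'.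
Proof.
elim: w y => [|a w IH] y /=; first by move=> <-.
by move=> [m am wm] [m' /(act_fun am) <-]; apply: IH.
Qed.

(** * Generic sections *)

(** Large domain and separatedness combined: locally, there is a section [u] on
which every listed composite of two letters is defined. *)
Lemma eq_on_generic (T : C) (G : seq (letter T * letter T)) (x y : X T) :
  (forall (T' : C) (f : hom T' T) (u : X T'),
    (forall g, List.In g G -> runs (res_word f [:: g.1; g.2]) u) ->
    res f x = res f y) ->
  x = y.
Proof.
(* The axiom requires a nonempty family. The padding pair [g0] needs a section
   of X over T, and the equality to be proved provides one. *)
move=> H; pose g0 : letter T * letter T := ((true, x), (true, x)).
pose g (i : 'I_(size G).+1) := nth g0 G i.
have [S covS memS] := chunk_large_domain (g := hX) (ltn0Sn (size G))
  (fun i => tilde_letter (g i).2) (fun i => tilde_letter (g i).1).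
apply: (chunk_separated hX covS) => T' f /memS[u domu].
apply: (H T' f u) => h hG.
have [i iG] : exists i : 'I_(size G).+1, g i = h.
  rewrite /g; elim: (G) hG => [|k K IH] //= [->|/IH[i iK]]; first by exists ord0.
  by exists (lift ord0 i); rewrite -iK.
have [d1 d2] := domu i; move: d1 d2; rewrite iG => d1 d2.
exists (papp d2); exists (papp d1); first by apply/(@lmul_letterE T h.1 (SliceObj f)); exists d1.
by exists (papp d2) => //; apply/(@lmul_letterE T h.2 (SliceObj f)); exists d2.
Qed.

(** At each intermediate value [m] of the run, [u] is required to be in the
domain of the next letter after lambda_[m]. By [act_product] this next letter
then sends [m u] to the next intermediate value times [u], where the condition
at the following step says that this last product is defined. The extra letter
[a] supplies that condition at the final value; it also shows that [w ++ [:: a]]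
is defined at [y u] although it need not be defined at [y]. *)
Lemma translate_run (T : C) (w : word T) (a : letter T) (y y' : X T) :
  run w y y' ->
  exists G : seq (letter T * letter T),
    forall (T' : C) (f : hom T' T) (u : X T'),
    (forall g, List.In g G -> runs (res_word f [:: g.1; g.2]) u) ->
    exists p q, [/\ product (res f y) u p, run (res_word f w) p q,
      product (res f y') u q & exists r, act (res_letter f a) q r].
Proof.
elim: w y => [|b w IH] y /=.
  move=> <-; exists [:: ((true, y), a)] => T' f u Gu.
  have [_ [p yu [r ap _]]] := Gu _ (or_introl erefl).
  by exists p, p; split=> //; exists r.
move=> [m bm /IH[G HG]]; exists (((true, y), b) :: G) => T' f u Gu.
have [_ [p yu [p' bp _]]] := Gu _ (or_introl erefl).
have [p1 [q [mu1 wq y'u aq]]] := HG T' f u (fun g gG => Gu g (or_intror gG)).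
exists p, q; split=> //; exists p1 => //.
by rewrite -(act_product (act_res f bm) yu bp mu1).
Qed.

(** Locally, finitely many words have a common point in their domains. The
induction is on a bound for the lengths of the words: a common point [z] for the
words without their last letter is moved to [z u], with [u] generic for all the
runs from [z]. *)
Lemma eq_on_common_domain (T : C) (ws : seq (word T)) (x y : X T) :
  (forall (T' : C) (f : hom T' T) (z : X T'),
    (forall w, List.In w ws -> runs (res_word f w) z) -> res f x = res f y) ->
  x = y.
Proof.
pose short n (vs : seq (word T)) := forall w, List.In w vs -> size w <= n.
have [n szn] : exists n, short n ws.
  elim: ws => [|w ws [n IH]]; first by exists 0.
  exists (maxn (size w) n) => v /= [<-|/IH vn]; first exact: leq_maxl.
  by rewrite leq_max vn orbT.
elim: n ws szn x y => [|n IH] ws szn x y H.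
  rewrite -(res1 x) -(res1 y); apply: (H _ _ x) => w /szn.
  by case: w => // _; exists (res (idh T) x); rewrite ?res1.
pose butlast (w : word T) := take n w.
apply: (IH (map butlast ws)) => [w /List.in_map_iff[v [<- _]]|T1 f z Hz].
  by rewrite size_take_min geq_minl.
have [G HG] : exists G : seq (letter T1 * letter T1),
    forall (T' : C) (g : hom T' T1) (u : X T'),
    (forall h, List.In h G -> runs (res_word g [:: h.1; h.2]) u) ->
    forall w, List.In w ws ->
      exists2 p, product (res g z) u p & runs (res_word g (res_word f w)) p.
  have {IH H} : forall w, List.In w ws ->
      size w <= n.+1 /\ runs (res_word f (take n w)) z.
    by move=> w wws; split; [exact: szn | apply: Hz; apply: List.in_map].
  elim: (ws) => [|w vs IH] Hvs; first by exists [::].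
  have [|G HG] := IH; first by move=> v vvs; apply: Hvs; right.
  have [szw [z' wz]] := Hvs w (or_introl erefl).
  (* The last letter of [w] if [w] has length n + 1, and otherwise a dummy, as
     [take n w] is then the whole of [w]. *)
  pose a : letter T1 := head (true, z) (res_word f (drop n w)).
  have [Gw HGw] := translate_run a wz.
  exists (Gw ++ G)%list => T' g u Gu v /= [<-|vvs]; last first.
    by apply: (HG T' g u) => // h hG; apply/Gu/List.in_or_app; right.
  have [|p [q [zu wq _ [r ar]]]] := HGw T' g u.
    by move=> h hG; apply/Gu/List.in_or_app; left.
  exists p => //; rewrite -(cat_take_drop n w) /res_word !map_cat.
  have : size (drop n w) <= 1 by rewrite size_drop leq_subLR addn1.
  move: ar; rewrite /a; case: (drop n w) => [|b [|//]] ar _.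
    by exists q; rewrite cats0.
  by exists r; apply/run_cat; exists q => //; exists r.
apply: (eq_on_generic (G := G)) => T2 g u /HG Hu.
rewrite -!res_comp.
(* All the words run from the same section [p = z u]; without any word there is
   no product to refer to, and any section does. *)
have [p Hp] : exists p, forall w, List.In w ws ->
    runs (res_word (comph f g) w) p.
  elim: (ws) Hu => [|w vs _] Hu; first by exists u.
  have [p zu _] := Hu w (or_introl erefl).
  exists p => v /Hu[q /(product_fun zu) <-]; by rewrite res_word_comp.
exact: (H T2 _ p).
Qed.

(** * Agreement and compatibility *)

(** Choose [u] and [s] with [y u = z s], both generic for the runs of [v] and
[w], and evaluate both words at this section in two ways. Genericity of
[s = lambda_z^dagger (lambda_y u)] involves composites of four letters at [u],
which is why common domains of long words are needed. *)
Lemma agree_at_one_point (T : C) (v w : word T) (y z a b c : X T) :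
  run v y a -> run w y a -> run v z b -> run w z c -> b = c.
Proof.
move=> vy wy vz wz.
(* Only the translated runs matter here; the extra letter [(true, y)] is
   arbitrary. *)
have [G1 HG1] := translate_run (true, y) vy.
have [G2 HG2] := translate_run (true, y) wy.
have [G3 HG3] := translate_run (true, y) vz.
have [G4 HG4] := translate_run (true, y) wz.
pose quot : word T := [:: (true, y); (false, z)].
pose pair_word (g : letter T * letter T) : word T := [:: g.1; g.2].
pose ws := (map pair_word (G1 ++ G2) ++
  quot :: map (fun g => quot ++ pair_word g) (G3 ++ G4))%list.
apply: (eq_on_common_domain (ws := ws)) => T' f u Hu.
have Hyu g : List.In g (G1 ++ G2)%list -> runs (res_word f (pair_word g)) u.
  by move=> hg; apply/Hu/List.in_or_app; left; apply: (List.in_map pair_word).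
have [s Hs] : runs (res_word f quot) u.
  by apply/Hu/List.in_or_app; right; left.
have Hzs g : List.In g (G3 ++ G4)%list -> runs (res_word f (pair_word g)) s.
  move=> hg; have : runs (res_word f (quot ++ pair_word g)) u.
    apply/Hu/List.in_or_app; right; right.
    exact: (List.in_map (fun g => quot ++ pair_word g)).
  rewrite /res_word map_cat => -[t /run_cat[s' /(run_fun Hs) <- st]].
  by exists t.
have [p yu [s' zs e]] := Hs; rewrite /act /= in yu zs; rewrite e {e s'} in zs.
have [|p1 [q1 [yp1 vq1 aq1 _]]] := HG1 T' f u.
  by move=> g gG; apply/Hyu/List.in_or_app; left.
have [|p2 [q2 [yp2 wq2 aq2 _]]] := HG2 T' f u.
  by move=> g gG; apply/Hyu/List.in_or_app; right.
have [|p3 [q3 [zp3 vq3 bq3 _]]] := HG3 T' f s.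
  by move=> g gG; apply/Hzs/List.in_or_app; left.
have [|p4 [q4 [zp4 wq4 cq4 _]]] := HG4 T' f s.
  by move=> g gG; apply/Hzs/List.in_or_app; right.
rewrite -(product_fun yu yp1) in vq1; rewrite -(product_fun yu yp2) in wq2.
rewrite -(product_fun zs zp3) in vq3; rewrite -(product_fun zs zp4) in wq4.
rewrite -(product_fun aq1 aq2) in wq2.
rewrite -(run_fun vq1 vq3) in bq3; rewrite -(run_fun wq2 wq4) in cq4.
exact: product_cancelr bq3 cq4.
Qed.

(** Over an object [o] of the slice category, the letters are restricted along the
structure morphism of [o]. *)
Lemma tilde_infty_word (T : C) (phi : partial (over X T) (over X T)) :
  tilde_infty hc phi ->
  exists w : word T, forall (o : slice T) (y z : over X T o),
    (exists d : dom phi o y, papp d = z) <-> run (res_word (arr o) w) y z.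
Proof.
elim=> {phi} [phi [x phix]|phi psi _ [v Hv] _ [w Hw]].
  have [a ->] : exists a, phi = lmul_letter a.
    by case: phix => ->; [exists (true, x) | exists (false, x)].
  exists [:: a] => o y z.
  by rewrite lmul_letterE; split=> [az|[_ az <-] //]; exists z.
exists (w ++ v) => o y z; rewrite /res_word map_cat run_cat; split.
  move=> [[d d'] <-]; exists (papp d); first by apply/Hw; exists d.
  by apply/Hv; exists d'.
move=> [m /Hw[d dm] /Hv[d' dz]]; rewrite -{}dm in d' dz.
by exists (ex_intro _ d d'); rewrite -dz.
Qed.

Lemma compatible_trans (T : C) (phi psi chi : partial (over X T) (over X T)) :
  tilde_infty hc phi -> tilde_infty hc psi -> tilde_infty hc chi ->
  compatible phi psi -> compatible psi chi -> compatible phi chi.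
Proof.
move=> /tilde_infty_word[w1 H1] /tilde_infty_word[w2 H2].
move=> /tilde_infty_word[w3 H3] c12 c23 o z d1 d3.
pose R := res_word (arr o).
apply: (eq_on_common_domain (ws := [:: R w1; R w2; R w3])) => T' f y Hy.
pose o' : slice T := SliceObj (comph (arr o) f).
have E w : res_word f (R w) = res_word (arr o') w by rewrite /= res_word_comp.
have [a1 r1] := Hy (R w1) (or_introl erefl).
have [a2 r2] := Hy (R w2) (or_intror (or_introl erefl)).
have [a3 r3] := Hy (R w3) (or_intror (or_intror (or_introl erefl))).
have [e1 E1] : exists d : dom phi o' y, papp d = a1 by apply/H1; rewrite -E.
have [e2 E2] : exists d : dom psi o' y, papp d = a2 by apply/H2; rewrite -E.
have [e3 E3] : exists d : dom chi o' y, papp d = a3 by apply/H3; rewrite -E.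
have a13 : a3 = a1 by rewrite -E1 -E3 (c12 _ _ e1 e2) (c23 _ _ e2 e3).
rewrite a13 in r3.
pose h : hom o' o := exist _ f erefl.
have b1 : run (res_word f (R w1)) (res f z) (res f (papp d1)).
  rewrite E; apply/(H1 o'); exists (mem_res h d1).
  exact: (papp_res (f := h) d1).
have b3 : run (res_word f (R w3)) (res f z) (res f (papp d3)).
  rewrite E; apply/(H3 o'); exists (mem_res h d3).
  exact: (papp_res (f := h) d3).
exact: (agree_at_one_point r1 r3 b1 b3).
Qed.

End Words.

Theorem mainTheorem8 (C : site) (X : presheaf C)
    (mu : partial (prod_presheaf X X) X) (hX : group_chunk mu) (T : C) :
  Equivalence (fun phi psi :
      {phi : partial (over X T) (over X T) |
        tilde_infty (chunk_cancellative hX) phi} =>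
    compatible (proj1_sig phi) (proj1_sig psi)).
Proof.
split.
- by move=> phi o z d d'; apply: papp_eq.
- by move=> phi psi c o z d d'; rewrite (c _ _ d' d).
- by move=> [phi p] [psi q] [chi r] /=; apply: (compatible_trans p q r).
Qed.
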